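(* For every integer $q\ge2$ and every $\rho\in[2,3]$, \[\log V^{\mathrm{m}}_\rho(T_{\mathrm{cw}}(q))\le\max_{\alpha\in[0,1]}\Big[H\big(\tfrac{2-\alpha}{3},\tfrac{2\alpha}{3},\tfrac{1-\alpha}{3}\big)+\tfrac{\alpha\rho}{3}\log q+\tfrac{\rho-2}{3}H\big(\tfrac{1-\alpha}{2},\alpha,\tfrac{1-\alpha}{2}\big)\Big].\]
   Context: Logarithms are base 2; $H(p_1,\dots,p_m)=-\sum p_i\log p_i$ (with $0\log0=0$) is the entropy. Tensors are trilinear forms $\sum T_{xyz}xyz$ over a field on finite variable sets; equivalent tensors differ by bijective renamings of $x$-, $y$-, $z$-variables separately; $\langle n,m,p\rangle=\sum x_{ij}y_{jk}z_{ki}$, tensors equivalent to it are matrix multiplication tensors, of volume $nmp$. Partitioned tensor: $X=\bigsqcup_iX_i$, $Y=\bigsqcup_jY_j$, $Z=\bigsqcup_kZ_k$, $T=\sum_sT_s$ with each constituent $T_s$ a nonzero tensor over $X_i,Y_j,Z_k$ for an annotation $s=(i,j,k)$; $\operatorname{supp}(T)$ = annotations. $T^{\otimes N}$ is partitioned by products of parts with constituents $T^{\otimes N}_s=\bigotimes_{t=1}^NT_{s_t}$, $s\in\operatorname{supp}(T)^N$. A partitioned restriction is obtained by zeroing all variables of some parts; its constituents are the surviving ones. Coppersmith--Winograd tensor: $T_{\mathrm{cw}}(q)=\sum_{i=1}^q(x_0y_iz_i+x_iy_0z_i+x_iy_iz_0)+x_0y_0z_{q+1}+x_0y_{q+1}z_0+x_{q+1}y_0z_0$,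 partitioned with $X_0=\{x_0\}$, $X_1=\{x_1,\dots,x_q\}$, $X_2=\{x_{q+1}\}$ and likewise for $Y,Z$; its six constituents are matrix multiplication tensors. Merging value (specialized to a tensor $T$ all of whose constituents are matrix multiplication tensors): $T'$ is a consistent restriction of $T^{\otimes N}$ if, for some partitioned restriction $R$ of $T^{\otimes N}$, the constituents of $R$ are partitioned into classes such that the sum of each class is equivalent to a matrix multiplication tensor, and the sums of distinct classes have pairwise disjoint sets of $x$-variables, of $y$-variables and of $z$-variables; these class sums are the constituents of $T'$. $V^{\mathrm{m}}_{\rho,N}(T)$ is the maximum of $\sum_{s}\mathrm{Vol}(T'_s)^{\rho/3}$ over all consistent restrictions $T'$ of $T^{\otimes N}$, and $V^{\mathrm{m}}_\rho(T)=\lim_{N\to\infty}V^{\mathrm{m}}_{\rho,N}(T)^{1/N}$ (the limit exists). *)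

(* Defs.v *)
From HB Require Import structures.
From mathcomp Require Import all_boot all_order all_algebra.
From mathcomp Require Import all_classical all_reals all_analysis.
From mathcomp Require Import ring.

Set Implicit Arguments.
Unset Strict Implicit.
Unset Printing Implicit Defensive.

Import Order.TTheory GRing.Theory Num.Theory.
Import numFieldNormedType.Exports.

Local Open Scope classical_set_scope.
Local Open Scope ring_scope.

Definition log2 (R : realType) (x : R) : R := ln x / ln 2.

(* [ln 0 = 0], so the convention [0 * log 0 = 0] holds. *)
Definition entropy (R : realType) (p : seq R) : R :=
  - \sum_(a <- p) a * log2 a.

(* The trilinear form [\sum t x y z * x * y * z]. *)
Definition tensor (F : fieldType) (X Y Z : finType) : Type := X -> Y -> Z -> F.

Definition monomial (F : fieldType) (X Y Z : finType) (a : X) (b : Y) (c : Z) :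
    tensor F X Y Z :=
  fun x y z => [&& x == a, y == b & z == c]%:R.
Arguments monomial F {X Y Z} a b c x y z.

(* The variables of a tensor are those which occur in it. For (sums of) matrix
   multiplication constituents this agrees with the union of the corresponding
   parts, as every variable of a matrix multiplication tensor occurs in it. *)
Definition xvars (F : fieldType) (X Y Z : finType) (t : tensor F X Y Z)
    : {set X} := [set x | [exists y, exists z, t x y z != 0]].
Definition yvars (F : fieldType) (X Y Z : finType) (t : tensor F X Y Z)
    : {set Y} := [set y | [exists x, exists z, t x y z != 0]].
Definition zvars (F : fieldType) (X Y Z : finType) (t : tensor F X Y Z)
    : {set Z} := [set z | [exists x, exists y, t x y z != 0]].

Definition renaming (A B : finType) (f : A -> B) (U : {set A}) (V : {set B}) :=
  {in U &, injective f} /\ f @: U = V.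

Definition equivalent (F : fieldType) (X Y Z X' Y' Z' : finType)
    (t : tensor F X Y Z) (t' : tensor F X' Y' Z') : Prop :=
  exists (f : X -> X') (g : Y -> Y') (h : Z -> Z'),
    [/\ renaming f (xvars t) (xvars t'),
        renaming g (yvars t) (yvars t'),
        renaming h (zvars t) (zvars t') &
        forall x y z, x \in xvars t -> y \in yvars t -> z \in zvars t ->
          t x y z = t' (f x) (g y) (h z)].

Definition matmul (F : fieldType) (n m p : nat)
    : tensor F ('I_n * 'I_m)%type ('I_m * 'I_p)%type ('I_p * 'I_n)%type :=
  fun x y z => \sum_(i < n) \sum_(j < m) \sum_(k < p)
    monomial F (i, j) (j, k) (k, i) x y z.
Arguments matmul : clear implicits.

Definition is_matmul_dims (F : fieldType) (X Y Z : finType)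
    (t : tensor F X Y Z) (n m p : nat) : Prop :=
  [/\ (0 < n)%N, (0 < m)%N, (0 < p)%N & equivalent t (matmul F n m p)].

Definition is_matmul (F : fieldType) (X Y Z : finType) (t : tensor F X Y Z)
    : Prop := exists n m p, is_matmul_dims t n m p.

(* The dimensions of a matrix multiplication tensor need not be unique, but
   their product is: see [volumeE]. *)
Definition volume (F : fieldType) (X Y Z : finType) (t : tensor F X Y Z) : nat :=
  xget 0%N [set v | exists n m p, is_matmul_dims t n m p /\ v = (n * m * p)%N].

Lemma matmulE (F : fieldType) (n m p : nat) (i : 'I_n) (j : 'I_m) (k : 'I_p) :
  matmul F n m p (i, j) (j, k) (k, i) = 1.
Proof.
rewrite /matmul (bigD1 i) //= (bigD1 j) //= (bigD1 k) //=.
rewrite /monomial !eqxx /= !big1 ?addr0 //.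
- move=> i' /negbTE ni; rewrite big1 // => j' _; rewrite big1 // => k' _.
  by rewrite xpair_eqE [i == i']eq_sym ni.
- move=> j' /negbTE nj; rewrite big1 // => k' _.
  by rewrite xpair_eqE [j == j']eq_sym nj andbF.
- move=> k' /negbTE nk.
  by rewrite !xpair_eqE [k == k']eq_sym nk !andbF.
Qed.

Lemma card_matmul (F : fieldType) (X Y Z : finType) (t : tensor F X Y Z)
    (n m p : nat) : is_matmul_dims t n m p ->
  [/\ #|xvars t| = (n * m)%N, #|yvars t| = (m * p)%N & #|zvars t| = (p * n)%N].
Proof.
case=> n0 m0 p0 [f [g [h [[fi fE] [gi gE] [hi hE] _]]]].
rewrite -(card_in_imset fi) -(card_in_imset gi) -(card_in_imset hi) fE gE hE.
split.
- rewrite -[n in RHS]card_ord -[m in RHS]card_ord -card_prod -cardsT.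
  apply: eq_card => -[i j]; rewrite !inE.
  apply/existsP; exists (j, Ordinal p0); apply/existsP; exists (Ordinal p0, i).
  by rewrite matmulE oner_eq0.
- rewrite -[m in RHS]card_ord -[p in RHS]card_ord -card_prod -cardsT.
  apply: eq_card => -[j k]; rewrite !inE.
  apply/existsP; exists (Ordinal n0, j); apply/existsP; exists (k, Ordinal n0).
  by rewrite matmulE oner_eq0.
- rewrite -[p in RHS]card_ord -[n in RHS]card_ord -card_prod -cardsT.
  apply: eq_card => -[k i]; rewrite !inE.
  apply/existsP; exists (i, Ordinal m0); apply/existsP; exists (Ordinal m0, k).
  by rewrite matmulE oner_eq0.
Qed.

Lemma volumeE (F : fieldType) (X Y Z : finType) (t : tensor F X Y Z)
    (n m p : nat) : is_matmul_dims t n m p -> volume t = (n * m * p)%N.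
Proof.
move=> tnmp; rewrite /volume; case: xgetP => [v _ [a [b [c [tabc ->]]]]|].
  have [x y z] := card_matmul tnmp; have [x' y' z'] := card_matmul tabc.
  apply/eqP; rewrite -(eqn_exp2r _ _ (isT : (0 < 2)%N)); apply/eqP.
  transitivity (#|xvars t| * #|yvars t| * #|zvars t|)%N.
    by rewrite x' y' z'; ring.
  by rewrite x y z; ring.
by move=> /(_ (n * m * p)%N) []; exists n, m, p.
Qed.

Record ptensor (F : fieldType) := PTensor {
  xvar : finType; yvar : finType; zvar : finType;
  xidx : finType; yidx : finType; zidx : finType;
  xpart : xvar -> xidx;
  ypart : yvar -> yidx;
  zpart : zvar -> zidx;
  coef : tensor F xvar yvar zvar }.
Arguments xpart {F} p x.
Arguments ypart {F} p y.
Arguments zpart {F} p z.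
Arguments coef {F} p x y z.

Definition annotation (F : fieldType) (T : ptensor F) : finType :=
  (xidx T * yidx T * zidx T)%type.

Definition constituent (F : fieldType) (T : ptensor F) (s : annotation T)
    : tensor F (xvar T) (yvar T) (zvar T) :=
  fun x y z => if (xpart T x, ypart T y, zpart T z) == s then coef T x y z else 0.

Definition supp (F : fieldType) (T : ptensor F) : {set annotation T} :=
  [set s | [exists x, exists y, exists z, constituent s x y z != 0]].

Definition ppow (F : fieldType) (T : ptensor F) (N : nat) : ptensor F :=
  @PTensor F
    {ffun 'I_N -> xvar T} {ffun 'I_N -> yvar T} {ffun 'I_N -> zvar T}
    {ffun 'I_N -> xidx T} {ffun 'I_N -> yidx T} {ffun 'I_N -> zidx T}
    (fun x => [ffun t => xpart T (x t)])
    (fun y => [ffun t => ypart T (y t)])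
    (fun z => [ffun t => zpart T (z t)])
    (fun x y z => \prod_(t < N) coef T (x t) (y t) (z t)).

(* [A], [B] and [C] are the parts whose variables are not zeroed. *)
Definition prestrict (F : fieldType) (T : ptensor F)
    (A : {set xidx T}) (B : {set yidx T}) (C : {set zidx T}) : ptensor F :=
  @PTensor F (xvar T) (yvar T) (zvar T) (xidx T) (yidx T) (zidx T)
    (xpart T) (ypart T) (zpart T)
    (fun x y z => if [&& xpart T x \in A, ypart T y \in B & zpart T z \in C]
                  then coef T x y z else 0).

Definition class_sum (F : fieldType) (T : ptensor F) (c : {set annotation T})
    : tensor F (xvar T) (yvar T) (zvar T) :=
  fun x y z => \sum_(s in c) constituent s x y z.

Definition consistent (F : fieldType) (T : ptensor F)
    (P : {set {set annotation T}}) : Prop :=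
  [/\ finset.partition P (supp T),
      forall c, c \in P -> is_matmul (class_sum c) &
      forall c d, c \in P -> d \in P -> c != d ->
        [/\ xvars (class_sum c) :&: xvars (class_sum d) = finset.set0,
            yvars (class_sum c) :&: yvars (class_sum d) = finset.set0 &
            zvars (class_sum c) :&: zvars (class_sum d) = finset.set0]].

(* A partitioned restriction together with classes of its annotations, which
   are those of the restricted tensor. *)
Definition restriction_data (F : fieldType) (T : ptensor F) : finType :=
  ({set xidx T} * {set yidx T} * {set zidx T} * {set {set annotation T}})%type.

Definition restricted (F : fieldType) (T : ptensor F) (r : restriction_data T)
    : ptensor F := prestrict r.1.1.1 r.1.1.2 r.1.2.

Definition classes_of (F : fieldType) (T : ptensor F) (r : restriction_data T)
    : {set {set annotation (restricted r)}} := r.2.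

(* The initial value [0] of the maximum is the value of the restriction which
   zeroes all the variables. *)
Definition merging_value_at (F : fieldType) (R : realType) (T : ptensor F)
    (rho : R) (N : nat) : R :=
  \big[Num.max/0]_(r : restriction_data (ppow T N) |
                     `[< consistent (classes_of r) >])
    \sum_(c in classes_of r) (volume (class_sum c))%:R `^ (rho / 3).

Definition merging_value (F : fieldType) (R : realType) (T : ptensor F)
    (rho : R) : R :=
  limn (fun N : nat => merging_value_at T rho N `^ (N%:R^-1)).

Definition cw_tensor (F : fieldType) (q : nat)
    : tensor F 'I_q.+2 'I_q.+2 'I_q.+2 :=
  fun x y z =>
    \sum_(1 <= i < q.+1)
      (monomial F ord0 (inord i) (inord i) x y z
       + monomial F (inord i) ord0 (inord i) x y z
       + monomial F (inord i) (inord i) ord0 x y z)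
    + monomial F ord0 ord0 ord_max x y z
    + monomial F ord0 ord_max ord0 x y z
    + monomial F ord_max ord0 ord0 x y z.
Arguments cw_tensor : clear implicits.

Definition cw_part (q : nat) (x : 'I_q.+2) : 'I_3 :=
  if x == ord0 then inord 0 else if x == ord_max then inord 2 else inord 1.

Definition cw (F : fieldType) (q : nat) : ptensor F :=
  PTensor (@cw_part q) (@cw_part q) (@cw_part q) (cw_tensor F q).
Arguments cw : clear implicits.

(* Main.v *)
(**
Let a class of constituents of a power of the Coppersmith-Winograd tensor merge
into <n,m,p>, with variables x_ij, y_jk, z_ki. Since q >= 2 and classes contain
whole constituents, at each coordinate one of the three families of letters is
constantly 0. Hence a monomial of the class is encoded by a word, and the number
M of those with exactly k = alpha N coordinates of type (0,1,1), (1,0,1) or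
(1,1,0) is at most q^k 2^(N H((1-alpha)/2, alpha, (1-alpha)/2)). For some k the
volume nmp is at most (N+1) M.

Give each x-, y- or z-variable the product weight in which the parts 0, 1, 2 have
probabilities (2-alpha)/3, 2 alpha/3, (1-alpha)/3. The product of the weights of
the three variables of a monomial then depends on k only, and Loomis-Whitney
bounds M^2 times that product by the product of the total weights of the x-, y-
and z-variables of the class. Splitting Vol^(rho/3) = Vol^(2/3) Vol^((rho-2)/3),
the first factor is controlled by these weights, whose sums over the disjoint
classes are at most 1, and the second one by the bound on M. This loses only
a factor (N+1)^2, which disappears in the limit.
*)
Require Import Defs.
From HB Require Import structures.
From mathcomp Require Import all_boot all_order all_algebra.
From mathcomp Require Import all_classical all_reals all_analysis.
From mathcomp Require Import zify ring lra.

Set Implicit Arguments.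
Unset Strict Implicit.
Unset Printing Implicit Defensive.

Import Order.TTheory GRing.Theory Num.Theory.
Import numFieldNormedType.Exports.

Local Open Scope classical_set_scope.
Local Open Scope ring_scope.

(** * Monomials and parts of the Coppersmith-Winograd tensor *)

Definition cw_mon (q : nat) (x y z : 'I_q.+2) : bool :=
  [|| [&& x == ord0, y == z & (0 < y < q.+1)%N],
      [&& y == ord0, x == z & (0 < x < q.+1)%N],
      [&& z == ord0, x == y & (0 < x < q.+1)%N],
      [&& x == ord0, y == ord0 & z == ord_max],
      [&& x == ord0, y == ord_max & z == ord0] |
      [&& x == ord_max, y == ord0 & z == ord0]].

(** This cyclic symmetry lets later arguments treat one of the three variable families and
    rotate. *)
Lemma cw_mon_rot (q : nat) (x y z : 'I_q.+2) : cw_mon x y z = cw_mon y z x.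
Proof.
rewrite /cw_mon !(eq_sym z) [y == x]eq_sym.
by apply/idP/idP => /or4P[||| /or3P[] ] /and3P[] /eqP ? /eqP ? h;
  subst; rewrite ?h ?eqxx ?orbT //=.
Qed.

Lemma cw_partE (q : nat) (x : 'I_q.+2) :
  cw_part x = (if x == ord0 then 0 else if x == ord_max then 2 else 1)%N :> nat.
Proof. by rewrite /cw_part; case: ifP => _; [|case: ifP => _]; rewrite inordK. Qed.

Lemma cw_part_eq1 (q : nat) (x : 'I_q.+2) :
  (cw_part x == 1%N :> nat) = (0 < x < q.+1)%N.
Proof.
rewrite cw_partE -!val_eqE /=; have := ltn_ord x.
by case: (x : nat) => [|k] //= h; case: ifP; lia.
Qed.

Lemma cw_part_eq0 (q : nat) (x : 'I_q.+2) :
  cw_part x = 0%N :> nat -> x = ord0.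
Proof. by rewrite cw_partE; case: eqP => // _; case: ifP. Qed.

(** The six families of monomials are disjoint and repeat no monomial, so no coefficients add up,
    whatever the characteristic of [F]. *)
Lemma cw_tensorE (F : fieldType) (q : nat) (x y z : 'I_q.+2) :
  cw_tensor F q x y z = (cw_mon x y z)%:R.
Proof.
have sumE (b : bool) (u v : 'I_q.+2) :
    \sum_(1 <= i < q.+1) [&& b, u == inord i & v == inord i]%:R =
    [&& b, u == v & (0 < u < q.+1)%N]%:R :> F.
  have [->|uv] := eqVneq u v; last first.
    rewrite andbF big1_seq // => i _; case: eqP => [ui|_] /=; rewrite ?andbF //.
    by case: eqP => [vi|_]; rewrite ?andbF // ui vi eqxx in uv *.
  case: b => /=; last by rewrite big1.
  under eq_bigr do rewrite andbb.
  case: (boolP (0 < v < q.+1)%N) => vq /=.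
    rewrite (bigD1_seq (val v)) /= ?mem_index_iota ?iota_uniq //=.
    rewrite inord_val eqxx big1_seq ?addr0 // => i /andP[iv].
    rewrite mem_index_iota => iq; case: eqP => // E.
    by move: iv; rewrite E inordK ?eqxx //; lia.
  rewrite big1_seq // => i; rewrite mem_index_iota => iq; case: eqP => // E.
  by move: vq; rewrite E inordK; lia.
rewrite /cw_tensor /monomial !big_split /= sumE.
rewrite (eq_bigr (fun i => [&& y == ord0, x == inord i & z == inord i]%:R : F)); last first.
  by move=> i _; rewrite andbCA.
rewrite sumE (eq_bigr (fun i => [&& z == ord0, x == inord i & y == inord i]%:R : F)); last first.
  by move=> i _; rewrite andbA andbC.
rewrite sumE /cw_mon -!val_eqE /=.
have := ltn_ord x; have := ltn_ord y; have := ltn_ord z.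
case: (x : nat) => [|a] /=; case: (y : nat) => [|b] /=; case: (z : nat) => [|c] //=;
  rewrite ?andbF ?andbT ?orbF ?addr0 ?add0r ?eqxx //= => hx hy hz;
  rewrite ?eqSS ?ltnS; repeat (case: eqP => ? //=); subst; rewrite ?ltnn ?addr0 ?add0r //;
  case: ltnP => // ?; rewrite ?addr0 ?add0r //; lia.
Qed.

Lemma cw_mon_part (q : nat) (x y z : 'I_q.+2) :
  cw_mon x y z -> (cw_part x + cw_part y + cw_part z = 2)%N.
Proof.
rewrite /cw_mon !cw_partE -!val_eqE /=.
move: (x : nat) (y : nat) (z : nat) => a b c.
by case: (a =P 0)%N; case: (b =P 0)%N; case: (c =P 0)%N; case: (a =P q.+1);
  case: (b =P q.+1); case: (c =P q.+1); lia.
Qed.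

Lemma cw_mon_letter (q : nat) (x y z : 'I_q.+2) :
  cw_mon x y z -> cw_part x = 1%N :> nat -> cw_part y = 1%N :> nat -> y = x.
Proof.
move=> + /eqP + /eqP; rewrite /cw_mon !cw_part_eq1 -!val_eqE /= => h hx hy.
by apply/val_inj => /=; lia.
Qed.

(** Next to a letter 0, the letter 0 pairs with [ord_max], [ord_max] with 0, and a middle letter
    with itself. This is what makes the later encoding of monomials by words decodable. *)
Lemma cw_mon_inj (q : nat) (y z z' : 'I_q.+2) :
  cw_mon ord0 y z -> cw_mon ord0 y z' -> z = z'.
Proof.
rewrite /cw_mon -!val_eqE /= => h h'; apply/val_inj => /=; lia.
Qed.

Lemma cw_mon_mixed (q : nat) (b : 'I_q.+2) :
  cw_part b = 1%N :> nat -> cw_mon b b ord0.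
Proof. by move/eqP; rewrite /cw_mon cw_part_eq1 => ->; rewrite !eqxx !orbT. Qed.

(** * Vanishing of one family of letters at each coordinate *)

(* If x_ij and y_jk carry the same letter 1 <= a <= q at a coordinate, so do x_ij'
   and y_j'k for some j' and any other letter b. A nonzero letter of z_k'i or z_ki'
   would then have to equal both a and b. *)
Lemma mixed_vanish (q : nat) (I J K : Type)
    (x : I -> J -> 'I_q.+2) (y : J -> K -> 'I_q.+2) (z : K -> I -> 'I_q.+2) :
  (2 <= q)%N ->
  (forall i j k, cw_mon (x i j) (y j k) (z k i)) ->
  (forall i j k (b : 'I_q.+2), cw_part (x i j) = 1%N :> nat ->
     cw_part (y j k) = 1%N :> nat -> cw_part b = 1%N :> nat ->
     exists j', x i j' = b /\ y j' k = b) ->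
  forall i j k, cw_part (x i j) = 1%N :> nat -> cw_part (y j k) = 1%N :> nat ->
  forall k' i', z k' i' = ord0.
Proof.
move=> q2 H swap i j k x1 y1 k' i'.
have yx := cw_mon_letter (H i j k) x1 y1.
(* A second middle letter is available because $q\ge2$: either 1 or 2 differs from the given one. *)
have [b [b1 xb]] : exists b : 'I_q.+2, cw_part b = 1%N :> nat /\ b != x i j.
  have [x2|] := eqVneq (x i j) (inord 1); last first.
    move=> x2; exists (inord 1); rewrite eq_sym; split=> //; apply/eqP.
    by rewrite cw_part_eq1 inordK; lia.
  exists (inord 2); rewrite x2 -val_eqE /= !inordK; [split=> //; apply/eqP|lia|lia].
  by rewrite cw_part_eq1 inordK; lia.
have [j' [xj' yj']] := swap i j k b x1 y1 b1.
have P a c d := cw_mon_part (H a c d).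
have L a c d := @cw_mon_letter q _ _ _ (H a c d).
have Lz a c d : cw_part (x a c) = 1%N :> nat -> cw_part (z d a) = 1%N :> nat ->
    x a c = z d a.
  by move=> h1 h2; apply: (cw_mon_letter _ h2 h1); rewrite cw_mon_rot.
have Ly a c d : cw_part (y c d) = 1%N :> nat -> cw_part (z d a) = 1%N :> nat ->
    z d a = y c d.
  by move=> h1 h2; apply: (cw_mon_letter _ h1 h2); rewrite -cw_mon_rot.
(* As [x i j] has part 1, the parts of [y j k'] and [z k' i] sum to 1. If the latter had part 1, its
   letter would equal both [x i j] and [b]. *)
have yk' : cw_part (y j k') = 1%N :> nat.
  have := P i j k'; have := P i j' k'; rewrite xj' b1 x1 => h1 h2.
  case: (cw_part (y j k') =P 1%N :> nat) => // /eqP hy.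
  have z1 : cw_part (z k' i) = 1%N :> nat by lia.
  have e1 := Lz _ _ _ x1 z1; have := Lz i j' k'; rewrite xj' b1 z1 => /(_ erefl erefl) e2.
  by rewrite e1 e2 eqxx in xb.
have xi' : cw_part (x i' j) = 1%N :> nat.
  have := P i' j k; have := P i' j' k; rewrite yj' b1 y1 => h1 h2.
  case: (cw_part (x i' j) =P 1%N :> nat) => // /eqP hy.
  have z1 : cw_part (z k i') = 1%N :> nat by lia.
  have e1 := Ly _ _ _ y1 z1; have := Ly i' j' k; rewrite yj' b1 z1 => /(_ erefl erefl) e2.
  by rewrite -yx -e1 e2 eqxx in xb.
by apply: cw_part_eq0; have := P i' j k'; rewrite yk' xi'; lia.
Qed.

(* Without mixed monomials all parts are 0 or 2; nonzero x_ij, y_j'k' and z_k''i''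
   would make all of x_i''j, y_jk', z_k'i'' zero, although their parts sum to 2. *)
Lemma coordinate_vanish (q : nat) (I J K : Type)
    (x : I -> J -> 'I_q.+2) (y : J -> K -> 'I_q.+2) (z : K -> I -> 'I_q.+2) :
  (2 <= q)%N ->
  (forall i j k, cw_mon (x i j) (y j k) (z k i)) ->
  (forall i j k (b : 'I_q.+2), cw_part (x i j) = 1%N :> nat ->
     cw_part (y j k) = 1%N :> nat -> cw_part b = 1%N :> nat ->
     exists j', x i j' = b /\ y j' k = b) ->
  (forall j k i (b : 'I_q.+2), cw_part (y j k) = 1%N :> nat ->
     cw_part (z k i) = 1%N :> nat -> cw_part b = 1%N :> nat ->
     exists k', y j k' = b /\ z k' i = b) ->
  (forall k i j (b : 'I_q.+2), cw_part (z k i) = 1%N :> nat ->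
     cw_part (x i j) = 1%N :> nat -> cw_part b = 1%N :> nat ->
     exists i', z k i' = b /\ x i' j = b) ->
  [\/ forall i j, x i j = ord0, forall j k, y j k = ord0 |
      forall k i, z k i = ord0].
Proof.
move=> q2 H swx swy swz.
have vz := mixed_vanish q2 H swx.
have Hy j k i : cw_mon (y j k) (z k i) (x i j) by rewrite -cw_mon_rot.
have vx := mixed_vanish q2 Hy swy.
have Hz k i j : cw_mon (z k i) (x i j) (y j k) by rewrite -cw_mon_rot.
have vy := mixed_vanish q2 Hz swz.
apply: contrapT => nv.
have P i j k := cw_mon_part (H i j k).
(* Parts summing to 2 contain either no 1 or exactly two, and each position of such a pair is
   excluded by one of [vz], [vy], [vx]. *)
have mixed i j k : [/\ cw_part (x i j) != 1%N :> nat, cw_part (y j k) != 1%N :> nat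
    & cw_part (z k i) != 1%N :> nat].
  have := P i j k.
  case: (cw_part (x i j) =P 1%N :> nat) => x1; case: (cw_part (y j k) =P 1%N :> nat) => y1;
  case: (cw_part (z k i) =P 1%N :> nat) => z1 //.
  all: try by lia.
  - by case: nv; constructor 3; apply: vz x1 y1.
  - by case: nv; constructor 2; apply: vy z1 x1.
  - by case: nv; constructor 1; apply: vx y1 z1.
have ex (A B : Type) (f : A -> B -> 'I_q.+2) : ~ (forall a b, f a b = ord0) ->
    exists a b, (cw_part (f a b) != 0%N :> nat).
  move=> nf; apply: contrapT => e; apply: nf => a b; apply: contrapT => fab; apply: e.
  by exists a, b; apply/eqP => /cw_part_eq0.
have [i1 [j1 X]] := ex _ _ x (fun h => nv (Or31 _ _ h)).
have [j2 [k2 Y]] := ex _ _ y (fun h => nv (Or32 _ _ h)).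
have [k3 [i3 Z]] := ex _ _ z (fun h => nv (Or33 _ _ h)).
have := P i3 j1 k2; have := P i1 j1 k2; have := P i3 j2 k2; have := P i3 j1 k3.
have [] := mixed i3 j1 k2; have [] := mixed i1 j1 k2; have [] := mixed i3 j2 k2;
have [] := mixed i3 j1 k3; lia.
Qed.

(** * Supports of matrix multiplication tensors and of class sums *)

Lemma matmul_neq0 (F : fieldType) (n m p : nat) (a : 'I_n * 'I_m)
    (b : 'I_m * 'I_p) (c : 'I_p * 'I_n) :
  matmul F n m p a b c != 0 -> [/\ b.1 = a.2, c.1 = b.2 & c.2 = a.1].
Proof.
move=> h; apply: contrapT => nabc; move: h; rewrite /matmul big1 ?eqxx // => i _.
rewrite big1 // => j _; rewrite big1 // => k _.
rewrite /monomial; case: eqP => //= ea; case: eqP => //= eb; case: eqP => //= ec.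
by case: nabc; rewrite ea eb ec.
Qed.

(* The support of a tensor equivalent to a matrix multiplication tensor: the
   variables are indexed as in [\sum x_ij y_jk z_ki]. *)
Record mm_support (X Y Z : Type) (S : X -> Y -> Z -> bool) (n m p : nat)
    (x : 'I_n -> 'I_m -> X) (y : 'I_m -> 'I_p -> Y) (z : 'I_p -> 'I_n -> Z) :
    Prop := MMSupport {
  mm_mem : forall i j k, S (x i j) (y j k) (z k i);
  mm_cover : forall a b c, S a b c ->
    exists i j k, [/\ a = x i j, b = y j k & c = z k i];
  mm_injx : forall i j i' j', x i j = x i' j' -> i = i' /\ j = j';
  mm_injy : forall j k j' k', y j k = y j' k' -> j = j' /\ k = k';
  mm_injz : forall k i k' i', z k i = z k' i' -> k = k' /\ i = i' }.

Lemma mm_support_rot (X Y Z : Type) (S : X -> Y -> Z -> bool) (n m p : nat)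
    (x : 'I_n -> 'I_m -> X) (y : 'I_m -> 'I_p -> Y) (z : 'I_p -> 'I_n -> Z) :
  mm_support S x y z -> mm_support (fun b c a => S a b c) y z x.
Proof.
case=> Sm Sc xi yi zi; split=> // [b c a /Sc[i [j [k [-> -> ->]]]]].
by exists j, k, i.
Qed.

Lemma is_matmul_support (F : fieldType) (X Y Z : finType) (t : tensor F X Y Z)
    (n m p : nat) : is_matmul_dims t n m p ->
  exists (x : 'I_n -> 'I_m -> X) (y : 'I_m -> 'I_p -> Y) (z : 'I_p -> 'I_n -> Z),
    mm_support (fun a b c => t a b c != 0) x y z.
Proof.
case=> n0 m0 p0 [f [g [h [[fi fE] [gi gE] [hi hE] tE]]]].
(* Since the dimensions are positive, every variable of the matrix multiplication tensor occurs in a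
   monomial and hence has a preimage under the renaming. *)
have xE (i : 'I_n) (j : 'I_m) : exists2 a, a \in xvars t & f a = (i, j).
  have /imsetP[a ? ?] : (i, j) \in f @: xvars t; last by exists a.
  rewrite fE inE; apply/existsP; exists (j, Ordinal p0).
  by apply/existsP; exists (Ordinal p0, i); rewrite matmulE oner_eq0.
have yE (j : 'I_m) (k : 'I_p) : exists2 a, a \in yvars t & g a = (j, k).
  have /imsetP[a ? ?] : (j, k) \in g @: yvars t; last by exists a.
  rewrite gE inE; apply/existsP; exists (Ordinal n0, j).
  by apply/existsP; exists (k, Ordinal n0); rewrite matmulE oner_eq0.
have zE (k : 'I_p) (i : 'I_n) : exists2 a, a \in zvars t & h a = (k, i).
  have /imsetP[a ? ?] : (k, i) \in h @: zvars t; last by exists a.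
  rewrite hE inE; apply/existsP; exists (i, Ordinal m0).
  by apply/existsP; exists (Ordinal m0, k); rewrite matmulE oner_eq0.
pose x i j := s2val (cid2 (xE i j)); pose y j k := s2val (cid2 (yE j k)).
pose z k i := s2val (cid2 (zE k i)).
have xf i j : f (x i j) = (i, j) by rewrite /x; case: cid2.
have yf j k : g (y j k) = (j, k) by rewrite /y; case: cid2.
have zf k i : h (z k i) = (k, i) by rewrite /z; case: cid2.
have xv i j : x i j \in xvars t by rewrite /x; case: cid2.
have yv j k : y j k \in yvars t by rewrite /y; case: cid2.
have zv k i : z k i \in zvars t by rewrite /z; case: cid2.
exists x, y, z; split.
- by move=> i j k; rewrite tE // xf yf zf matmulE oner_eq0.
- move=> a b c tabc.
  have av : a \in xvars t.
    by rewrite inE; apply/existsP; exists b; apply/existsP; exists c.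
  have bv : b \in yvars t.
    by rewrite inE; apply/existsP; exists a; apply/existsP; exists c.
  have cv : c \in zvars t.
    by rewrite inE; apply/existsP; exists a; apply/existsP; exists b.
  have := tabc; rewrite tE // => /matmul_neq0[e1 e2 e3].
  exists (f a).1, (f a).2, (g b).2; split.
  + by apply: fi; rewrite // xf -surjective_pairing.
  + by apply: gi; rewrite // yf -e1 -surjective_pairing.
  + by apply: hi; rewrite // zf -e2 -e3 -surjective_pairing.
- by move=> i j i' j' /(congr1 f); rewrite !xf => -[].
- by move=> j k j' k' /(congr1 g); rewrite !yf => -[].
- by move=> k i k' i' /(congr1 h); rewrite !zf => -[].
Qed.

(** Distinct constituents have disjoint supports, so nothing cancels in a class sum. *)
Lemma class_sum_neq0 (F : fieldType) (T : ptensor F) (c : {set annotation T})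
    (x : xvar T) (y : yvar T) (z : zvar T) :
  (class_sum c x y z != 0) =
  ((xpart T x, ypart T y, zpart T z) \in c) && (coef T x y z != 0).
Proof.
rewrite /class_sum /constituent; set s := (_, _, _).
have [sc|sc] /= := boolP (s \in c); last first.
  by rewrite big1 ?eqxx // => s' s'c; case: eqP => // E; rewrite -E (negbTE sc) in s'c.
rewrite (bigD1 s) //= eqxx big1 ?addr0 // => s' /andP[_ s's].
by rewrite eq_sym (negbTE s's).
Qed.

(* [S] is the support of a sum of constituents of a power of the
   Coppersmith-Winograd tensor. *)
Definition cw_union (q N : nat)
    (S : {ffun 'I_N -> 'I_q.+2} -> {ffun 'I_N -> 'I_q.+2} ->
         {ffun 'I_N -> 'I_q.+2} -> bool) : Prop :=
  (forall a b c, S a b c -> forall t, cw_mon (a t) (b t) (c t)) /\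
  (forall a b c (a' b' c' : {ffun 'I_N -> 'I_q.+2}), S a b c ->
     (forall t, cw_part (a' t) = cw_part (a t)) ->
     (forall t, cw_part (b' t) = cw_part (b t)) ->
     (forall t, cw_part (c' t) = cw_part (c t)) ->
     (forall t, cw_mon (a' t) (b' t) (c' t)) -> S a' b' c').

Lemma cw_union_rot (q N : nat) S :
  @cw_union q N S -> cw_union (fun b c a => S a b c).
Proof.
case=> Sm Sf; split=> [b c a /Sm + t|b c a b' c' a' Sabc eb ec ea m].
  by move=> /(_ t); rewrite cw_mon_rot.
by apply: Sf Sabc ea eb ec _ => t; rewrite cw_mon_rot.
Qed.

(** Both the class and the zeroing of parts see only the part of each variable, so a monomial of the
    power is kept or dropped together with its whole constituent. *)
Lemma class_sum_union (F : fieldType) (q N : nat)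
    (r : restriction_data (ppow (cw F q) N)) (c : {set annotation (restricted r)}) :
  @cw_union q N (fun x y z => class_sum c x y z != 0).
Proof.
have E (x y z : {ffun 'I_N -> 'I_q.+2}) : (class_sum c x y z != 0) =
    [&& (xpart (restricted r) x, ypart (restricted r) y, zpart (restricted r) z) \in c,
        [&& xpart (restricted r) x \in r.1.1.1, ypart (restricted r) y \in r.1.1.2
          & zpart (restricted r) z \in r.1.2]
      & [forall t, cw_mon (x t) (y t) (z t)]].
  rewrite class_sum_neq0 /=; congr (_ && _).
  case: ifP => // _ /=; last by rewrite eqxx.
  rewrite prodf_seq_neq0; apply/allP/forallP => /= [h t|h t _].
    have := h t (mem_index_enum _); rewrite cw_tensorE.
    by case: cw_mon; rewrite ?eqxx.
  by rewrite cw_tensorE h oner_eq0.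
split=> [x y z|x y z x' y' z']; rewrite E => /and3P[hc hr /forallP m] //.
move=> ex ey ez m'; rewrite E /=.
have -> : [ffun t => cw_part (x' t)] = [ffun t => cw_part (x t)].
  by apply/ffunP => t; rewrite !ffunE.
have -> : [ffun t => cw_part (y' t)] = [ffun t => cw_part (y t)].
  by apply/ffunP => t; rewrite !ffunE.
have -> : [ffun t => cw_part (z' t)] = [ffun t => cw_part (z t)].
  by apply/ffunP => t; rewrite !ffunE.
by apply/and3P; split=> //; apply/forallP.
Qed.

(* Changing a letter of the middle part stays inside a constituent, and the
   unchanged z-variable fixes [i] and [k]. *)
Lemma mm_swap (q N n m p : nat) S x y z (t : 'I_N) :
  @cw_union q N S -> @mm_support _ _ _ S n m p x y z ->
  forall i j k (b : 'I_q.+2), cw_part (x i j t) = 1%N :> nat ->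
    cw_part (y j k t) = 1%N :> nat -> cw_part b = 1%N :> nat ->
    exists j', x i j' t = b /\ y j' k t = b.
Proof.
move=> [Sm Sf] mm i j k b x1 y1 b1.
pose upd (a : {ffun 'I_N -> 'I_q.+2}) := [ffun u => if u == t then b else a u].
have Sb : S (upd (x i j)) (upd (y j k)) (z k i).
  have H := mm_mem mm i j k.
  apply: (Sf _ _ _ _ _ _ H) => // u; rewrite !ffunE; case: eqP => [->|_] //.
  - by apply/val_inj; rewrite /= x1 b1.
  - by apply/val_inj; rewrite /= y1 b1.
  - have := cw_mon_part (Sm _ _ _ H t); rewrite x1 y1 => z0.
    by rewrite (@cw_part_eq0 q (z k i t)) ?cw_mon_mixed //; lia.
  - exact: Sm H u.
have [i' [j' [k' [ex ey /(mm_injz mm)[ek ei]]]]] := mm_cover mm Sb; subst i' k'.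
by exists j'; rewrite -ex -ey !ffunE eqxx.
Qed.

Lemma mm_vanish (q N n m p : nat) S x y z (t : 'I_N) : (2 <= q)%N ->
  @cw_union q N S -> @mm_support _ _ _ S n m p x y z ->
  [\/ forall i j, x i j t = ord0, forall j k, y j k t = ord0 |
      forall k i, z k i t = ord0].
Proof.
move=> q2 Su mm; apply: (coordinate_vanish q2 (x := fun i j => x i j t)
  (y := fun j k => y j k t) (z := fun k i => z k i t)).
- by move=> i j k; apply: (proj1 Su); apply: mm_mem mm i j k.
- exact: mm_swap Su mm.
- exact: mm_swap (cw_union_rot Su) (mm_support_rot mm).
- exact: mm_swap (cw_union_rot (cw_union_rot Su)) (mm_support_rot (mm_support_rot mm)).
Qed.

(** * Product weights and the Loomis-Whitney inequality *)

Lemma sum_cw_part (V : nmodType) (q : nat) (g : nat -> V) :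
  \sum_(l < q.+2) g (cw_part l) = g 0%N + g 1%N *+ q + g 2%N.
Proof.
rewrite big_ord_recl big_ord_recr /= !cw_partE eqxx /= addrA; congr (_ + _ + g _).
  rewrite -[q in RHS]card_ord -sumr_const; apply: eq_bigr => i _; congr g.
  by apply/eqP; rewrite cw_part_eq1 /= /bump /=; have := ltn_ord i; lia.
by rewrite -!val_eqE /= /bump /= add1n eqxx.
Qed.

Lemma sum_prod_weight (R : comPzRingType) (N : nat) (L : finType) (w : L -> R) :
  \sum_l w l = 1 -> \sum_(x : {ffun 'I_N -> L}) \prod_(t < N) w (x t) = 1.
Proof.
move=> w1; rewrite -(bigA_distr_bigA (fun _ : 'I_N => w)) /=.
by rewrite w1 big1.
Qed.

Lemma prod_if (R : comPzRingType) (N : nat) (d : pred 'I_N) (a b : R) :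
  \prod_(t < N) (if d t then a else b) = a ^+ #|d| * b ^+ (N - #|d|).
Proof.
rewrite (bigID d) /=; congr (_ * _).
  by rewrite (eq_bigr (fun=> a)) ?prodr_const // => t ->.
rewrite (eq_bigr (fun=> b)) => [|t /negbTE ->//].
by rewrite prodr_const -[X in (X - _)%N](card_ord N) -(cardC d) addKn.
Qed.

(** With $a=\sum f_i^2$, $b=\sum g_i^2$, $c=\sum f_ig_i$, the nonnegative sum of $(ag_i-cf_i)^2$
    equals $a(ab-c^2)$. If $a=0$, all $f_i$ vanish. *)
Lemma sum_Cauchy_Schwarz (R : realDomainType) (I : finType) (f g : I -> R) :
  (\sum_i f i * g i) ^+ 2 <= (\sum_i f i ^+ 2) * (\sum_i g i ^+ 2).
Proof.
set a := \sum_i f i ^+ 2; set b := \sum_i g i ^+ 2; set c := \sum_i f i * g i.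
have a0 : 0 <= a by apply: sumr_ge0 => i _; rewrite sqr_ge0.
have : 0 <= \sum_i (a * g i - c * f i) ^+ 2.
  by apply: sumr_ge0 => i _; rewrite sqr_ge0.
have -> : \sum_i (a * g i - c * f i) ^+ 2 = a * (a * b - c ^+ 2).
  rewrite (eq_bigr (fun i => a ^+ 2 * g i ^+ 2 - 2 * a * c * (f i * g i)
     + c ^+ 2 * f i ^+ 2)) => [|i _]; last by ring.
  by rewrite big_split /= sumrB -!mulr_sumr -/a -/b -/c; ring.
have [az|an] := eqVneq a 0; last first.
  by rewrite pmulr_rge0 ?subr_ge0 // lt_neqAle eq_sym an.
move=> _; have f0 i : f i = 0.
  apply/eqP; rewrite -sqrf_eq0; apply/eqP.
  exact: (psumr_eq0P (fun j _ => sqr_ge0 (f j)) az).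
have -> : c = 0 by rewrite /c big1 // => i _; rewrite f0 mul0r.
by rewrite az mul0r expr2 !mul0r lexx.
Qed.

(** Cauchy-Schwarz is applied twice: over the pairs $(j,k)$, then over $i$ for each fixed pair. *)
Lemma sum_Loomis_Whitney (R : realDomainType) (I J K : finType)
    (f : I -> J -> R) (g : J -> K -> R) (h : K -> I -> R) :
  (\sum_i \sum_j \sum_k f i j * g j k * h k i) ^+ 2 <=
  (\sum_i \sum_j f i j ^+ 2) * (\sum_j \sum_k g j k ^+ 2)
    * (\sum_k \sum_i h k i ^+ 2).
Proof.
pose F (u : J * K) := g u.1 u.2; pose G (u : J * K) := \sum_i f i u.1 * h u.2 i.
have -> : \sum_i \sum_j \sum_k f i j * g j k * h k i = \sum_u F u * G u.
  rewrite exchange_big /= -(pair_big xpredT xpredT (fun j k => F (j, k) * G (j, k))) /=.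
  apply: eq_bigr => j _; rewrite exchange_big /=; apply: eq_bigr => k _.
  by rewrite /F /G mulr_sumr; apply: eq_bigr => i _ /=; rewrite mulrCA mulrA.
apply: le_trans (sum_Cauchy_Schwarz _ _) _.
rewrite -(pair_big xpredT xpredT (fun j k => F (j, k) ^+ 2)) /=.
rewrite [X in X * _ <= _](_ : _ = \sum_j \sum_k g j k ^+ 2) //.
rewrite [X in _ <= X * _]mulrC -mulrA; apply: ler_wpM2l.
  by apply: sumr_ge0 => j _; apply: sumr_ge0 => k _; rewrite sqr_ge0.
rewrite -(pair_big xpredT xpredT (fun j k => G (j, k) ^+ 2)) /=.
rewrite [X in _ <= X * _]exchange_big mulr_suml; apply: ler_sum => j _.
rewrite mulr_sumr; apply: ler_sum => k _; exact: sum_Cauchy_Schwarz.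
Qed.

(** * Counting the monomials of a class by their mixed coordinates *)

(** For a monomial the parts sum to 2, so the absence of part 2 means type (0,1,1), (1,0,1) or
    (1,1,0). *)
Definition mixed (q : nat) (x y z : 'I_q.+2) : bool :=
  [&& cw_part x != 2 :> nat, cw_part y != 2 :> nat & cw_part z != 2 :> nat]%N.

Lemma cw_mon_weight (R : comPzRingType) (q : nat) (g : nat -> R)
    (x y z : 'I_q.+2) : cw_mon x y z ->
  g (cw_part x) * g (cw_part y) * g (cw_part z) =
  if mixed x y z then g 0%N * g 1%N ^+ 2 else g 0%N ^+ 2 * g 2%N.
Proof.
move=> /cw_mon_part; rewrite /mixed.
move: (cw_part x : nat) (cw_part y : nat) (cw_part z : nat) => [|[|[|a]]] [|[|[|b]]] [|[|[|c]]] //= _;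
  ring.
Qed.

(** The type of a monomial can be read off from the single letter that the encoding keeps; the
    cyclic choice of that letter matches the word built in [mixed_card_le]. *)
Lemma mixedE (q : nat) (x y z : 'I_q.+2) : cw_mon x y z ->
  [/\ x = ord0 -> mixed x y z = (cw_part y == 1%N :> nat),
      y = ord0 -> mixed x y z = (cw_part z == 1%N :> nat) &
      z = ord0 -> mixed x y z = (cw_part x == 1%N :> nat)].
Proof.
move=> /cw_mon_part; have c0 : cw_part (@ord0 q.+1) = 0%N :> nat by rewrite cw_partE.
rewrite /mixed => h; split=> E; move: h; rewrite E c0.
all: move: (cw_part x : nat) (cw_part y : nat) (cw_part z : nat) => a b c; lia.
Qed.

Definition word_weight (R : comPzRingType) (q N : nat) (g : nat -> R)
    (x : {ffun 'I_N -> 'I_q.+2}) : R := \prod_(t < N) g (cw_part (x t)).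

Lemma word_weight_ge0 (R : numDomainType) (q N : nat) (g : nat -> R)
    (x : {ffun 'I_N -> 'I_q.+2}) : (forall a, 0 <= g a) -> 0 <= word_weight g x.
Proof. by move=> g0; apply: prodr_ge0. Qed.

Lemma sum_word_weight (R : comPzRingType) (q N : nat) (g : nat -> R) :
  g 0%N + g 1%N *+ q + g 2%N = 1 ->
  \sum_(x : {ffun 'I_N -> 'I_q.+2}) word_weight g x = 1.
Proof.
move=> g1; apply: (sum_prod_weight _ (w := fun l : 'I_q.+2 => g (cw_part l))).
by rewrite sum_cw_part.
Qed.

Definition mixed_count (q N n m p : nat) (x : 'I_n -> 'I_m -> {ffun 'I_N -> 'I_q.+2})
    (y : 'I_m -> 'I_p -> {ffun 'I_N -> 'I_q.+2})
    (z : 'I_p -> 'I_n -> {ffun 'I_N -> 'I_q.+2}) (u : 'I_n * 'I_m * 'I_p) : nat :=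
  #|[pred t | mixed (x u.1.1 u.1.2 t) (y u.1.2 u.2 t) (z u.2 u.1.1 t)]|.

Lemma mixed_count_le (q N n m p : nat) x y z u :
  (@mixed_count q N n m p x y z u <= N)%N.
Proof. by rewrite -[X in (_ <= X)%N](card_ord N) max_card. Qed.

(** Pigeonhole on the $N+1$ possible values: a value with the largest fibre is taken. *)
Lemma exists_popular_count (T : finType) (N : nat) (f : T -> nat) :
  (forall u, f u <= N)%N ->
  exists2 k, (k <= N)%N & (#|T| <= N.+1 * #|[pred u | f u == k]|)%N.
Proof.
move=> fN; pose c (k : 'I_N.+1) := #|[pred u | f u == k]|.
have [k _ kmax] := arg_maxnP c (erefl : xpredT (@ord0 N)).
exists (val k); first by rewrite -ltnS ltn_ord.
rewrite -sum1_card (partition_big (fun u => inord (f u) : 'I_N.+1) xpredT) //=.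
rewrite -[X in (_ <= X * _)%N](card_ord N.+1) -sum_nat_const.
apply: leq_sum => i _; apply: leq_trans (kmax i isT); rewrite /c -sum1_card.
rewrite (eq_bigl [pred u | f u == i]) // => u /=; rewrite -val_eqE /= inordK //.
by rewrite ltnS.
Qed.

Section MatmulClass.
Variables (R : realType) (q N n m p : nat).
Variables (S : {ffun 'I_N -> 'I_q.+2} -> {ffun 'I_N -> 'I_q.+2} ->
  {ffun 'I_N -> 'I_q.+2} -> bool).
Variables (x : 'I_n -> 'I_m -> {ffun 'I_N -> 'I_q.+2})
  (y : 'I_m -> 'I_p -> {ffun 'I_N -> 'I_q.+2})
  (z : 'I_p -> 'I_n -> {ffun 'I_N -> 'I_q.+2}).
Hypotheses (Su : cw_union S) (mm : mm_support S x y z).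

Let mon i j k t : cw_mon (x i j t) (y j k t) (z k i t).
Proof. by apply: (proj1 Su); apply: mm_mem mm i j k. Qed.

(** Loomis-Whitney is applied to the square roots of the weights. By [cw_mon_weight] each monomial
    with [k] mixed coordinates contributes the square root of the factor [D]; the others contribute
    nonnegative amounts. *)
Lemma mixed_card_sqr (g : nat -> R) (k : nat) : (forall a, 0 <= g a) ->
  #|[pred u | mixed_count x y z u == k]|%:R ^+ 2
    * ((g 0%N * g 1%N ^+ 2) ^+ k * (g 0%N ^+ 2 * g 2%N) ^+ (N - k)) <=
  (\sum_i \sum_j word_weight g (x i j)) * (\sum_j \sum_k word_weight g (y j k))
    * (\sum_k \sum_i word_weight g (z k i)).
Proof.
move=> g0; set D := (X in _ * X <= _).
have D0 : 0 <= D by rewrite mulr_ge0 // exprn_ge0 // mulr_ge0 // exprn_ge0.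
have w0 := word_weight_ge0 _ g0.
have := sum_Loomis_Whitney (fun i j => Num.sqrt (word_weight g (x i j)))
  (fun j k => Num.sqrt (word_weight g (y j k)))
  (fun k i => Num.sqrt (word_weight g (z k i))).
under [X in _ <= X * _ * _ -> _]eq_bigr do under eq_bigr do rewrite sqr_sqrtr //.
under [X in _ <= _ * X * _ -> _]eq_bigr do under eq_bigr do rewrite sqr_sqrtr //.
under [X in _ <= _ * _ * X -> _]eq_bigr do under eq_bigr do rewrite sqr_sqrtr //.
apply: le_trans; rewrite -[X in _ * X <= _](sqr_sqrtr D0) -exprMn.
rewrite ler_pXn2r ?nnegrE //; last first.
  apply: sumr_ge0 => i _; apply: sumr_ge0 => j _; apply: sumr_ge0 => l _.
  by rewrite !mulr_ge0 // sqrtr_ge0.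
rewrite pair_big /= pair_big /=.
rewrite mulr_natl -sumr_const big_mkcond /=; apply: ler_sum => -[[i j] l] _ /=.
case: ifP => [|_]; last by rewrite !mulr_ge0 // sqrtr_ge0.
rewrite inE => /eqP uk; rewrite -!sqrtrM // ?mulr_ge0 //; apply: ler_wsqrtr.
rewrite /word_weight -!big_split /=.
under eq_bigr do rewrite cw_mon_weight //.
rewrite (prod_if (fun t => mixed (x i j t) (y j l t) (z l i t))).
by rewrite /D -uk.
Qed.

(** Monomials are encoded injectively by words. When each middle letter weighs [a] and each of the
    two extreme letters [b], all words together weigh 1, and the word of a monomial with [k] mixed
    coordinates weighs $a^kb^{N-k}$. *)
Lemma mixed_card_le (a b : R) (k : nat) : (2 <= q)%N ->
  0 <= a -> 0 <= b -> b + a *+ q + b = 1 ->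
  #|[pred u | mixed_count x y z u == k]|%:R * (a ^+ k * b ^+ (N - k)) <= 1.
Proof.
move=> q2 a0 b0 ab1.
pose zx t := [forall i, forall j, x i j t == ord0].
pose zy t := [forall j, forall l, y j l t == ord0].
(* At each coordinate one of the three letters is constantly 0 and any one of the
   other two determines the monomial. *)
pose w (u : 'I_n * 'I_m * 'I_p) : {ffun 'I_N -> 'I_q.+2} :=
  [ffun t => if zx t then y u.1.2 u.2 t
             else if zy t then z u.2 u.1.1 t else x u.1.1 u.1.2 t].
have zP t : [\/ zx t /\ forall i j, x i j t = ord0,
    [/\ ~~ zx t, zy t & forall j l, y j l t = ord0] |
    [/\ ~~ zx t, ~~ zy t & forall l i, z l i t = ord0]].
  case: (boolP (zx t)) => [zt|nx].
    by constructor 1; split=> // i j; move/forallP: zt => /(_ i) /forallP/(_ j)/eqP.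
  case: (boolP (zy t)) => [zt|ny].
    by constructor 2; split=> // j l; move/forallP: zt => /(_ j) /forallP/(_ l)/eqP.
  constructor 3; split=> //; case: (mm_vanish t q2 Su mm) => // h.
    by case/negP: nx; apply/forallP => i; apply/forallP => j; rewrite h.
  by case/negP: ny; apply/forallP => i; apply/forallP => j; rewrite h.
(* The vanishing letter and the recorded one determine the third, so equal words give equal
   variables at every coordinate; these determine the indices. *)
have winj : injective w.
  move=> [[i j] l] [[i' j'] l'] E.
  have et t : [/\ x i j t = x i' j' t, y j l t = y j' l' t & z l i t = z l' i' t].
    have := congr1 (fun f : {ffun 'I_N -> 'I_q.+2} => f t) E; rewrite !ffunE /=.
    have := mon i j l t; have := mon i' j' l' t.
    case: (zP t) => [[-> h]|[/negbTE -> -> h]|[/negbTE -> /negbTE -> h]].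
    - rewrite !h => h1 h2 e; split=> //; move: h1; rewrite -e => h1.
      exact: cw_mon_inj h2 h1.
    - rewrite !h => + + e; rewrite -e 2!(cw_mon_rot _ ord0) => h1 h2; split=> //.
      exact: cw_mon_inj h2 h1.
    - rewrite !h => + + e; rewrite -e -2!(cw_mon_rot ord0) => h1 h2; split=> //.
      exact: cw_mon_inj h2 h1.
  have [-> ->] : i = i' /\ j = j' by apply: (mm_injx mm); apply/ffunP => t; case: (et t).
  have [_ ->//] : j = j' /\ l = l' by apply: (mm_injy mm); apply/ffunP => t; case: (et t).
pose g (c : nat) := if c == 1%N then a else b.
have g0 c : 0 <= g c by rewrite /g; case: ifP.
rewrite -[leRHS](@sum_word_weight R q N g) //.
rewrite mulr_natl -sumr_const.
apply: (@le_trans _ _ (\sum_(u | mixed_count x y z u == k) word_weight g (w u))).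
  rewrite le_eqVlt; apply/orP; left; apply/eqP; apply: eq_big => // -[[i j] l] /=; rewrite inE => /eqP uk.
  rewrite /word_weight (eq_bigr (fun t => if mixed (x i j t) (y j l t) (z l i t)
    then a else b)) => [|t _]; last first.
    have [h1 h2 h3] := mixedE (mon i j l t); rewrite /g ffunE /=.
    case: (zP t) => [[-> h]|[/negbTE -> -> h]|[/negbTE -> /negbTE -> h]].
    - by rewrite h1.
    - by rewrite h2.
    - by rewrite h3.
  by rewrite (prod_if (fun t => mixed (x i j t) (y j l t) (z l i t))) -uk.
rewrite -(big_imset _ (in2W winj)) /=.
rewrite [leRHS](bigID (mem [set w u | u in [pred u | mixed_count x y z u == k]]%SET)) /=.
by rewrite lerDl sumr_ge0 // => u _; apply: word_weight_ge0.
Qed.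

End MatmulClass.

(** * Sums over the variables of disjoint classes *)

Lemma sum_inj_le (R : numDomainType) (I J W : finType) (h : I -> J -> W)
    (F : W -> R) (A : {set W}) :
  (forall i j i' j', h i j = h i' j' -> i = i' /\ j = j') ->
  (forall i j, h i j \in A) -> (forall w, 0 <= F w) ->
  \sum_i \sum_j F (h i j) <= \sum_(w in A) F w.
Proof.
move=> hi hA F0; pose h' (u : I * J) := h u.1 u.2.
have h'i : injective h' by move=> [i j] [i' j'] /hi[/= -> ->].
rewrite pair_big /= -(big_imset (h := h') F (in2W h'i)) /=.
rewrite [leRHS](bigID (mem (h' @: [set: I * J])%SET)) /=.
rewrite -[leLHS]addr0; apply: lerD; last by apply: sumr_ge0.
rewrite le_eqVlt; apply/orP; left; apply/eqP; apply: eq_bigl => w.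
apply/imsetP/andP => [[u _ ->]|[_ /imsetP[u _ ->]]]; last by exists u.
by split; [exact: hA|exact: imset_f].
Qed.

Lemma sum_disjoint_le (R : numDomainType) (I W : finType) (P : {set I})
    (A : I -> {set W}) (F : W -> R) :
  (forall c d, c \in P -> d \in P -> c != d -> A c :&: A d = finset.set0) ->
  (forall w, 0 <= F w) ->
  \sum_(c in P) \sum_(w in A c) F w <= \sum_w F w.
Proof.
move=> dis F0; rewrite (exchange_big_dep xpredT) //=; apply: ler_sum => w _.
have [c /andP[cP wc]|nc] := pickP [pred c | (c \in P) && (w \in A c)]; last first.
  by rewrite big_pred0.
rewrite (bigD1 c) ?cP //= big1 ?addr0 // => d /andP[/andP[dP wd] dc].
rewrite eq_sym in dc; have := congr1 (fun B : {set W} => w \in B) (dis _ _ cP dP dc).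
by rewrite !inE wc wd.
Qed.

Lemma mm_vars (F : fieldType) (X Y Z : finType) (t : tensor F X Y Z)
    (n m p : nat) x y z : (0 < n)%N -> (0 < m)%N -> (0 < p)%N ->
  @mm_support X Y Z (fun a b c => t a b c != 0) n m p x y z ->
  [/\ forall i j, x i j \in xvars t, forall j k, y j k \in yvars t
    & forall k i, z k i \in zvars t].
Proof.
move=> n0 m0 p0 mm; have M := mm_mem mm; split=> [i j|j k|k i]; rewrite inE.
- by apply/existsP; exists (y j (Ordinal p0)); apply/existsP; exists (z (Ordinal p0) i).
- by apply/existsP; exists (x (Ordinal n0) j); apply/existsP; exists (z k (Ordinal n0)).
- by apply/existsP; exists (x i (Ordinal m0)); apply/existsP; exists (y (Ordinal m0) k).
Qed.

(** * Volume of a single class *)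

Lemma AGM_three (R : realFieldType) (a b c : R) : 0 <= a -> 0 <= b -> 0 <= c ->
  a * b * c <= ((a + b + c) / 3) ^+ 3.
Proof.
move=> a0 b0 c0.
(* The difference of the two sides is a nonnegative combination of terms $u(v-w)^2$ with $u,v,w$
   among $a,b,c$. *)
have h (u v w : R) (u0 : 0 <= u) := mulr_ge0 u0 (sqr_ge0 (v - w)).
have := h _ a b a0; have := h _ b c a0; have := h _ a c a0.
have := h _ a b b0; have := h _ b c b0; have := h _ a c b0.
have := h _ a b c0; have := h _ b c c0; have := h _ a c c0.
lra.
Qed.

(** Here [V] is the volume, [M] the number of monomials with the popular count, [C] the pigeonhole
    loss, and [a], [b], [c] are the weights of the three variable families. AM-GM turns their
    product into a sum, which can be added over classes. *)
Lemma class_volume_bound (R : realType) (rho V M D E C a b c : R) :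
  2 <= rho -> 0 < V -> 0 < D -> 0 < E -> 0 < C -> 0 <= a -> 0 <= b -> 0 <= c ->
  V <= C * M -> M ^+ 2 * D <= a * b * c -> M * E <= 1 ->
  V `^ (rho / 3) <=
  (a + b + c) / 3 * expR (rho / 3 * ln C - ln D / 3 - (rho - 2) / 3 * ln E).
Proof.
move=> rho2 V0 D0 E0 C0 a0 b0 c0 VM MD ME.
have M0 : 0 < M by rewrite -(pmulr_rgt0 _ C0); apply: lt_le_trans VM.
set s := (a + b + c) / 3.
have sD : M ^+ 2 * D <= s ^+ 3 by apply: le_trans MD (AGM_three a0 b0 c0).
have s0 : 0 < s.
  rewrite lt_neqAle (_ : 0 <= s) ?andbT; last by rewrite /s; lra.
  apply/eqP => s0; have := mulr_gt0 (exprn_gt0 2 M0) D0.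
  by rewrite ltNge (le_trans sD) // -s0 expr0n.
have sE : expR (ln s) = s by rewrite lnK ?posrE.
rewrite -[X in _ <= X * _]sE -expRD /powR gt_eqF // ler_expR.
have l1 : ln V <= ln C + ln M by rewrite -lnM ?posrE // ler_ln ?posrE // mulr_gt0.
have l2 : 2 * ln M + ln D <= 3 * ln s.
  have : ln (M ^+ 2 * D) <= ln (s ^+ 3).
    by rewrite ler_ln ?posrE //; [exact: mulr_gt0 (exprn_gt0 _ M0) D0|exact: exprn_gt0].
  rewrite lnM ?posrE ?exprn_gt0 //.
  by rewrite !lnXn // -[ln M *+ 2]mulr_natl -[ln s *+ 3]mulr_natl.
have l3 : ln M + ln E <= 0 by rewrite -lnM ?posrE // ln_le0.
(* The bounds [l1], [l2], [l3] are combined with coefficients $\rho/3$, $1/3$ and $(\rho-2)/3$. *)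
nra.
Qed.

(** * The exponent as a function of alpha *)

Definition cw_exponent (R : realType) (q : nat) (rho alpha : R) : R :=
  entropy [:: (2 - alpha) / 3; 2 * alpha / 3; (1 - alpha) / 3]
  + alpha * rho / 3 * log2 q%:R
  + (rho - 2) / 3 * entropy [:: (1 - alpha) / 2; alpha; (1 - alpha) / 2].

(* The letter weights which make a word of the type maximizing the entropy have
   weight 2^(-N H) / q^(number of letters in the middle part). *)
Definition cw_weight (R : realType) (q : nat) (alpha : R) (a : nat) : R :=
  match a with
  | 0 => (2 - alpha) / 3
  | 1 => 2 * alpha / 3 / q%:R
  | _ => (1 - alpha) / 3
  end.

(** With $H_1,H_2$ the two entropies, $-\ln D/3=N\ln2\,(H_1+\frac{2\alpha}3\log q)$ and $-\ln
    E=N\ln2\,(H_2+\alpha\log q)$; the multiples of $\log q$ add up to $\alpha\rho/3$. *)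
Lemma cw_exponentE (R : realType) (q N k : nat) (rho : R)
    (alpha := k%:R / N%:R : R) (g := cw_weight q alpha)
    (D := (g 0%N * g 1%N ^+ 2) ^+ k * (g 0%N ^+ 2 * g 2%N) ^+ (N - k))
    (E := (alpha / q%:R) ^+ k * ((1 - alpha) / 2) ^+ (N - k)) :
  (0 < q)%N -> (0 < N)%N -> (k <= N)%N ->
  [/\ 0 < D, 0 < E &
   - (ln D / 3) - (rho - 2) / 3 * ln E = N%:R * ln 2 * cw_exponent q rho alpha].
Proof.
move=> q0 N0 kN.
have qR : 0 < q%:R :> R by rewrite ltr0n.
have NR : 0 < N%:R :> R by rewrite ltr0n.
have aE : N%:R * alpha = k%:R by rewrite /alpha mulrC divfK // gt_eqF.
have a0 : 0 <= alpha by rewrite divr_ge0 // ler0n.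
have a1 : alpha <= 1 by rewrite ler_pdivrMr // mul1r ler_nat.
have akE : (0 < k)%N -> 0 < alpha by move=> k0; rewrite divr_gt0 // ltr0n.
have aNE : (0 < N - k)%N -> alpha < 1.
  by move=> k0; rewrite ltr_pdivrMr // mul1r ltr_nat -subn_gt0.
have p0 : 0 < g 0%N by rewrite /g /=; lra.
have [l1 D1] : ln ((g 0%N * g 1%N ^+ 2) ^+ k) =
    k%:R * (ln ((2 - alpha) / 3) + 2 * (ln (2 * alpha / 3) - ln q%:R))
    /\ 0 < (g 0%N * g 1%N ^+ 2) ^+ k.
  (* For $k=0$ the base is 0 but its zeroth power is 1, so positivity and the logarithm formula
     survive at the boundary; likewise for $k=N$ below. *)
  case: (posnP k) => [->|k0]; first by rewrite expr0 ln1 mul0r.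
  have al := akE k0; have p1 : 0 < 2 * alpha / 3 by lra.
  have p1' : 0 < g 1%N by rewrite /g /= divr_gt0.
  have P := mulr_gt0 p0 (exprn_gt0 2 p1'); split; last exact: exprn_gt0.
  rewrite lnXn // lnM ?posrE ?exprn_gt0 // lnXn //.
  by rewrite [ln (g 1%N)]ln_div ?posrE // -[_ *+ k]mulr_natl -[_ *+ 2]mulr_natl.
have [l2 D2] : ln ((g 0%N ^+ 2 * g 2%N) ^+ (N - k)) =
    (N - k)%:R * (2 * ln ((2 - alpha) / 3) + ln ((1 - alpha) / 3))
    /\ 0 < (g 0%N ^+ 2 * g 2%N) ^+ (N - k).
  case: (posnP (N - k)) => [->|k0]; first by rewrite expr0 ln1 mul0r.
  have al := aNE k0; have p2 : 0 < g 2%N by rewrite /g /=; lra.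
  have P := mulr_gt0 (exprn_gt0 2 p0) p2; split; last exact: exprn_gt0.
  rewrite lnXn // lnM ?posrE ?exprn_gt0 // lnXn //.
  by rewrite -[_ *+ (N - k)]mulr_natl -[_ *+ 2]mulr_natl.
have [l3 E1] : ln ((alpha / q%:R) ^+ k) = k%:R * (ln alpha - ln q%:R)
    /\ 0 < (alpha / q%:R) ^+ k.
  case: (posnP k) => [->|k0]; first by rewrite expr0 ln1 mul0r.
  have al := akE k0; have P := divr_gt0 al qR; split; last exact: exprn_gt0.
  by rewrite lnXn // ln_div ?posrE // mulr_natl.
have [l4 E2] : ln (((1 - alpha) / 2) ^+ (N - k)) = (N - k)%:R * ln ((1 - alpha) / 2)
    /\ 0 < ((1 - alpha) / 2) ^+ (N - k).
  case: (posnP (N - k)) => [->|k0]; first by rewrite expr0 ln1 mul0r.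
  have al := aNE k0; have p2 : 0 < (1 - alpha) / 2 by lra.
  by split; [rewrite lnXn // mulr_natl|exact: exprn_gt0].
split; rewrite ?mulr_gt0 //.
rewrite /D /E !lnM ?posrE // l1 l2 l3 l4 natrB // -aE.
have ln2 : ln 2 != 0 :> R by rewrite gt_eqF // ln_gt0 // ltr1n.
rewrite /cw_exponent /entropy /log2 !big_cons !big_nil.
move: (ln 2) ln2 (ln q%:R) (ln ((2 - alpha) / 3)) (ln (2 * alpha / 3))
  (ln ((1 - alpha) / 3)) (ln alpha) (ln ((1 - alpha) / 2)) (N%:R : R) (alpha : R).
by clear; move=> c c0 lq a0 a1 a2 b1 b0 M a; field.
Qed.

Lemma entropy_term (R : realType) (a : R) : 0 <= a <= 1 ->
  0 <= - (a * log2 a) <= (ln 2)^-1.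
Proof.
move=> /andP[a0 a1]; have l2 : 0 < ln 2 :> R by rewrite ln_gt0 // ltr1n.
rewrite /log2 mulrA -mulNr divr_ge0 ?(ltW l2) //=; last first.
  by rewrite oppr_ge0 mulr_ge0_le0 // ln_le0.
rewrite ler_pdivrMr // mulVf ?gt_eqF //.
have [->|an] := eqVneq a 0; first by rewrite mul0r oppr0.
have ap : 0 < a by rewrite lt_neqAle eq_sym an.
have ai : 0 < a^-1 by rewrite invr_gt0.
have := ln_sublinear ai; rewrite lnV ?posrE // => h.
rewrite -mulrN -(mulfV an) ler_pM2l //; exact: ltW.
Qed.

Lemma entropy3_bounds (R : realType) (a b c : R) :
  0 <= a <= 1 -> 0 <= b <= 1 -> 0 <= c <= 1 ->
  0 <= entropy [:: a; b; c] <= 3 / ln 2.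
Proof.
move=> /entropy_term ha /entropy_term hb /entropy_term hc.
by rewrite /entropy !big_cons big_nil; lra.
Qed.

(** The upper bound makes the supremum meaningful; nonnegativity settles the cases where the
    logarithm of the limit takes its default value. *)
Lemma cw_exponent_bounds (R : realType) (q : nat) (rho alpha : R) :
  (0 < q)%N -> 2 <= rho <= 3 -> 0 <= alpha <= 1 ->
  0 <= cw_exponent q rho alpha <= 6 / ln 2 + log2 q%:R.
Proof.
move=> q0 r a; have l2 : 0 < ln 2 :> R by rewrite ln_gt0 // ltr1n.
have lq : 0 <= log2 q%:R :> R by rewrite divr_ge0 ?(ltW l2) // ln_ge0 // ler1n.
have /andP[e1 e1'] : 0 <= entropy [:: (2 - alpha) / 3; 2 * alpha / 3; (1 - alpha) / 3]
  <= 3 / ln 2 by apply: entropy3_bounds; lra.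
have /andP[e2 e2'] : 0 <= entropy [:: (1 - alpha) / 2; alpha; (1 - alpha) / 2]
  <= 3 / ln 2 by apply: entropy3_bounds; lra.
rewrite /cw_exponent; move: e1 e1' e2 e2'; set X := entropy _; set Y := entropy _.
move=> e1 e1' e2 e2'.
have t0 : 0 <= alpha * rho / 3 by rewrite divr_ge0 ?mulr_ge0; lra.
have t1 : alpha * rho / 3 <= 1 by nra.
have u0 : 0 <= alpha * rho / 3 * log2 q%:R by rewrite mulr_ge0.
have u1 : alpha * rho / 3 * log2 q%:R <= log2 q%:R by rewrite ler_piMl.
have v0 : 0 <= (rho - 2) / 3 * Y by rewrite mulr_ge0 //; lra.
have v1 : (rho - 2) / 3 * Y <= Y by rewrite ler_piMl //; lra.
lra.
Qed.

(** * Summation over the classes *)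

(** The average of the three total weights is the form produced by AM-GM; alpha is $k/N$. *)
Definition vars_weight (R : realType) (q N k : nat)
    (A B C : {set {ffun 'I_N -> 'I_q.+2}}) : R :=
  let W := word_weight (cw_weight q (k%:R / N%:R)) in
  (\sum_(x in A) W x + \sum_(y in B) W y + \sum_(z in C) W z) / 3.

Lemma cw_weight_ge0 (R : realType) (q N k a : nat) : (k <= N)%N -> (0 < N)%N ->
  0 <= cw_weight q (k%:R / N%:R : R) a.
Proof.
move=> kN N0; have a0 : 0 <= k%:R / N%:R :> R by rewrite divr_ge0 // ler0n.
have a1 : k%:R / N%:R <= 1 :> R by rewrite ler_pdivrMr ?ltr0n // mul1r ler_nat.
by case: a => [|[|a]] /=; rewrite ?divr_ge0 ?ler0n //; lra.
Qed.

Lemma vars_weight_ge0 (R : realType) (q N k : nat)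
    (A B C : {set {ffun 'I_N -> 'I_q.+2}}) : (k <= N)%N -> (0 < N)%N ->
  0 <= vars_weight R k A B C.
Proof.
move=> kN N0; rewrite divr_ge0 // !addr_ge0 // sumr_ge0 // => x _;
  apply: word_weight_ge0 => a; exact: cw_weight_ge0.
Qed.

Lemma vars_weight_ge (R : realType) (q N k n m p : nat) S
    (A B C : {set {ffun 'I_N -> 'I_q.+2}}) x y z
    (W := word_weight (cw_weight q (k%:R / N%:R : R))) :
  (k <= N)%N -> (0 < N)%N -> @mm_support _ _ _ S n m p x y z ->
  (forall i j, x i j \in A) -> (forall j l, y j l \in B) ->
  (forall l i, z l i \in C) ->
  (\sum_i \sum_j W (x i j) + \sum_j \sum_l W (y j l) + \sum_l \sum_i W (z l i)) / 3
  <= vars_weight R k A B C.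
Proof.
move=> kN N0 mm xA yB zC; rewrite /vars_weight -/W ler_pM2r ?invr_gt0 //.
have W0 w : 0 <= W w by apply: word_weight_ge0 => a; exact: cw_weight_ge0.
apply: lerD; last exact: sum_inj_le (mm_injz mm) zC W0.
exact: lerD (sum_inj_le (mm_injx mm) xA W0) (sum_inj_le (mm_injy mm) yB W0).
Qed.

Lemma sum_vars_weight_le (R : realType) (q N k : nat) (I : finType) (P : {set I})
    (A B C : I -> {set {ffun 'I_N -> 'I_q.+2}}) :
  (0 < q)%N -> (0 < N)%N -> (k <= N)%N ->
  (forall c d, c \in P -> d \in P -> c != d ->
     [/\ A c :&: A d = finset.set0, B c :&: B d = finset.set0 &
         C c :&: C d = finset.set0]) ->
  \sum_(c in P) vars_weight R k (A c) (B c) (C c) <= 1.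
Proof.
move=> q0 N0 kN dis.
pose W : {ffun 'I_N -> 'I_q.+2} -> R := word_weight (cw_weight q (k%:R / N%:R)).
have W0 w : 0 <= W w by apply: word_weight_ge0 => a; exact: cw_weight_ge0.
have W1 : \sum_w W w = 1.
  apply: sum_word_weight => /=; rewrite -[X in _ + X + _]mulr_natr divfK.
    by move: (k%:R / N%:R) => alpha; field.
  by rewrite pnatr_eq0; lia.
have dx : \sum_(c in P) \sum_(w in A c) W w <= \sum_w W w.
  by apply: sum_disjoint_le => // c d cP dP cd; case: (dis c d cP dP cd).
have dy : \sum_(c in P) \sum_(w in B c) W w <= \sum_w W w.
  by apply: sum_disjoint_le => // c d cP dP cd; case: (dis c d cP dP cd).
have dz : \sum_(c in P) \sum_(w in C c) W w <= \sum_w W w.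
  by apply: sum_disjoint_le => // c d cP dP cd; case: (dis c d cP dP cd).
rewrite /vars_weight -/W -mulr_suml !big_split /= ler_pdivrMr // mul1r.
by rewrite W1 in dx dy dz; lra.
Qed.

(** The popular count depends on the class. Summing the bound over all [k] removes this dependence,
    so that classes can later be added for each [k] separately. *)
Lemma class_value_le (F : fieldType) (R : realType) (q N : nat) (rho s : R)
    (r : restriction_data (ppow (cw F q) N)) (c : {set annotation (restricted r)}) :
  (2 <= q)%N -> (0 < N)%N -> 2 <= rho <= 3 ->
  (forall alpha, 0 <= alpha <= 1 -> cw_exponent q rho alpha <= s) ->
  is_matmul (class_sum c) ->
  (volume (class_sum c))%:R `^ (rho / 3) <=
  \sum_(k < N.+1) @vars_weight R q N k (xvars (class_sum c))
    (yvars (class_sum c)) (zvars (class_sum c))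
  * expR (ln N.+1%:R + N%:R * ln 2 * s).
Proof.
move=> q2 N0 /andP[r2 r3] fs [n [m [p cm]]]; rewrite (volumeE cm).
have Su := class_sum_union c; have [n0 m0 p0 _] := cm.
have [x [y [z mm]]] := is_matmul_support cm.
have [xv yv zv] := mm_vars n0 m0 p0 mm.
have [k kN Vk] := exists_popular_count (mixed_count_le x y z).
have q0 : (0 < q)%N by lia.
have qR : 0 < q%:R :> R by rewrite ltr0n.
have NR : 0 < N%:R :> R by rewrite ltr0n.
pose alpha : R := k%:R / N%:R.
have a0 : 0 <= alpha by rewrite divr_ge0 // ler0n.
have a1 : alpha <= 1 by rewrite ler_pdivrMr // mul1r ler_nat.
have g0 a : 0 <= cw_weight q alpha a by exact: cw_weight_ge0.
have [D0 E0 DE] := cw_exponentE rho q0 N0 kN.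
pose W : {ffun 'I_N -> 'I_q.+2} -> R := word_weight (cw_weight q alpha).
have w0 x' : 0 <= W x' by apply: word_weight_ge0.
have h1 := mixed_card_sqr Su mm k g0.
have h2 : #|[pred u | mixed_count x y z u == k]|%:R
    * ((alpha / q%:R) ^+ k * ((1 - alpha) / 2) ^+ (N - k)) <= 1.
  apply: (mixed_card_le Su mm) => //; [by rewrite divr_ge0 // ltW|lra|].
  by rewrite -[X in _ + X + _]mulr_natr divfK ?gt_eqF //; field.
have wle := vars_weight_ge R kN N0 mm xv yv zv.
have nn (A B : finType) (h : A -> B -> {ffun 'I_N -> 'I_q.+2}) :
    0 <= \sum_i \sum_j W (h i j) by apply: sumr_ge0 => i _; apply: sumr_ge0 => j _.
have V0 : 0 < (n * m * p)%:R :> R by rewrite ltr0n !muln_gt0 n0 m0.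
have VM : (n * m * p)%:R <=
    N.+1%:R * #|[pred u | mixed_count x y z u == k]|%:R :> R.
  by move: Vk; rewrite !card_prod !card_ord -natrM ler_nat.
have := class_volume_bound r2 V0 D0 E0 (ltr0Sn R N) (nn _ _ x) (nn _ _ y)
  (nn _ _ z) VM h1 h2.
move/le_trans; apply.
rewrite (bigD1 (Ordinal (kN : (k < N.+1)%N))) //= -[leLHS]addr0.
apply: lerD; last first.
  apply: sumr_ge0 => j _; rewrite mulr_ge0 ?expR_ge0 // vars_weight_ge0 //.
  by rewrite -ltnS.
apply: ler_pM; rewrite ?expR_ge0 //.
  by rewrite divr_ge0 // !addr_ge0.
rewrite ler_expR -addrA DE.
have lN : 0 <= ln N.+1%:R :> R by rewrite ln_ge0 // ler1n.
have fa := fs alpha; have l2 : 0 < ln 2 :> R by rewrite ln_gt0 // ltr1n.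
(* Since $\rho\le3$, the pigeonhole loss $(N+1)^{\rho/3}$ is at most $N+1$. *)
apply: lerD; first by nra.
by rewrite ler_pM2l ?mulr_gt0 // fa // a0 a1.
Qed.

Lemma consistent_value_le (F : fieldType) (R : realType) (q N : nat) (rho s : R)
    (r : restriction_data (ppow (cw F q) N)) :
  (2 <= q)%N -> (0 < N)%N -> 2 <= rho <= 3 ->
  (forall alpha, 0 <= alpha <= 1 -> cw_exponent q rho alpha <= s) ->
  consistent (classes_of r) ->
  \sum_(c in classes_of r) (volume (class_sum c))%:R `^ (rho / 3) <=
  N.+1%:R * expR (ln N.+1%:R + N%:R * ln 2 * s).
Proof.
move=> q2 N0 rr fs [_ mmP dis].
apply: le_trans (ler_sum _ (fun c cP => class_value_le q2 N0 rr fs (mmP c cP))) _.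
set e := expR _; have -> : N.+1%:R * e = \sum_(k < N.+1) e.
  by rewrite sumr_const card_ord mulr_natl.
(* For fixed [k] all classes share one weight function, and by disjointness their weights sum to at
   most 1. *)
rewrite exchange_big /=.
apply: ler_sum => k _; rewrite -mulr_suml ler_piMl ?expR_ge0 //.
have q0 : (0 < q)%N by lia.
have kN : (k <= N)%N by rewrite -ltnS.
exact: (@sum_vars_weight_le R q N k _ (classes_of r) (fun c => xvars (class_sum c))
  (fun c => yvars (class_sum c)) (fun c => zvars (class_sum c)) q0 N0 kN dis).
Qed.

Lemma merging_value_at_le (F : fieldType) (R : realType) (q N : nat) (rho s : R) :
  (2 <= q)%N -> (0 < N)%N -> 2 <= rho <= 3 ->
  (forall alpha, 0 <= alpha <= 1 -> cw_exponent q rho alpha <= s) ->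
  merging_value_at (cw F q) rho N <= expR (2 * ln N.+1%:R + N%:R * ln 2 * s).
Proof.
move=> q2 N0 rr fs; rewrite /merging_value_at; apply: bigmax_le => [|r /asboolP cr].
  exact: expR_ge0.
apply: le_trans (consistent_value_le q2 N0 rr fs cr) _.
have NE : N.+1%:R = expR (ln N.+1%:R) :> R by rewrite lnK // posrE ltr0n.
by rewrite [X in X * _ <= _]NE -expRD ler_expR; lra.
Qed.

(** * Passage to the limit *)

(** For $u=\sqrt{N+1}$, $\ln u<u$ gives $2\ln(N+1)\le4u$, and $16(N+1)\le32N\le(Ne)^2$ once
    $Ne^2\ge128$. *)
Lemma ln_natS_le (R : realType) (N : nat) (e : R) : 0 < e -> 128 / e ^+ 2 <= N%:R ->
  (0 < N)%N -> 2 * ln N.+1%:R <= N%:R * e.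
Proof.
move=> e0 Ne N0; have N1 : 1 <= N%:R :> R by rewrite ler1n.
have P : 0 < N.+1%:R :> R by rewrite ltr0n.
have s0 : 0 < Num.sqrt N.+1%:R :> R by rewrite sqrtr_gt0.
have -> : ln N.+1%:R = 2 * ln (Num.sqrt N.+1%:R) :> R.
  by rewrite -[X in ln X](sqr_sqrtr (ltW P)) lnXn // mulr_natl.
have := ln_sublinear s0; set u := Num.sqrt _ => lu.
have uu : u ^+ 2 = N%:R + 1 by rewrite sqr_sqrtr ?(ltW P) // -natr1.
have e2 : 0 < e ^+ 2 by rewrite exprn_gt0.
move: Ne; rewrite ler_pdivrMr // => Ne.
suff : 4 * u <= N%:R * e by lra.
have u0 : 0 <= 4 * u by rewrite mulr_ge0 // sqrtr_ge0.
have Ne0 : 0 <= N%:R * e by rewrite mulr_ge0 // ltW.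
rewrite -ler_sqr ?nnegrE //.
rewrite !exprMn uu; nra.
Qed.

Theorem mainTheorem9 (F : fieldType) (R : realType) (q : nat) (rho : R)
    (hq : (2 <= q)%N) (hrho : 2 <= rho <= 3) :
  log2 (merging_value (cw F q) rho) <=
  sup [set entropy [:: (2 - alpha) / 3; 2 * alpha / 3; (1 - alpha) / 3]
           + alpha * rho / 3 * log2 q%:R
           + (rho - 2) / 3
             * entropy [:: (1 - alpha) / 2; alpha; (1 - alpha) / 2]
      | alpha in [set a : R | 0 <= a <= 1]].
Proof.
set A := (X in sup X).
have q0 : (0 < q)%N by lia.
have fs alpha : 0 <= alpha <= 1 -> cw_exponent q rho alpha <= sup A.
  move=> ha; apply: ub_le_sup; last by exists alpha.
  exists (6 / ln 2 + log2 q%:R) => _ [a a01 <-].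
  by have /andP[] := cw_exponent_bounds q0 hrho a01.
have s0 : 0 <= sup A.
  have h0 : 0 <= (0 : R) <= 1 by rewrite lexx ler01.
  by apply: le_trans (fs _ h0); have /andP[] := cw_exponent_bounds q0 hrho h0.
have l2 : 0 < ln 2 :> R by rewrite ln_gt0 // ltr1n.
rewrite {1}/log2 ler_pdivrMr // /merging_value.
set u := (fun N : nat => _).
(* Without convergence [limn] would be the default point 0, and [ln] is 0 on nonpositive reals, so
   [s0] suffices; a nonpositive limit is treated alike. *)
have [cu|/dvgP ->] := pselect (cvgn u); last first.
  by rewrite ln0 // mulr_ge0 // ltW.
have [l0|l0] := leP (limn u) 0; first by rewrite ln0 // mulr_ge0 // ltW.
apply/ler_addgt0Pr => e e0.
rewrite -ler_expR lnK ?posrE //; apply: limr_le => //.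
near=> N.
have N0 : (0 < N)%N by near: N; exact: nbhs_infty_gt.
have Ne : 128 / e ^+ 2 <= N%:R by near: N; exact: nbhs_infty_ger.
have NR : 0 < N%:R :> R by rewrite ltr0n.
have V := @merging_value_at_le F R q N rho (sup A) hq N0 hrho fs.
have V0 : 0 <= merging_value_at (cw F q) rho N by exact: bigmax_ge_id.
rewrite /u; apply: (@le_trans _ _ (expR (2 * ln N.+1%:R + N%:R * ln 2 * sup A) `^ N%:R^-1)).
  by rewrite ge0_ler_powR ?nnegrE ?expR_ge0 // invr_ge0 ltW.
rewrite /powR gt_eqF ?expR_gt0 // expRK ler_expR.
(* Multiplied by $N$, the error allowance becomes $Ne$, which absorbs $2\ln(N+1)$ for large $N$. *)
rewrite -ler_pdivlMl ?invr_gt0 // invrK.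
have := ln_natS_le e0 Ne N0; lra.
Unshelve. all: by end_near.
Qed.
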